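(* Let $M_1=(J,\Sigma,\mu,\mathcal F_1)$ and $M_2=(J,\Sigma,\mu,\mathcal F_2)$ be measurable matroids on the same standard measure space, with rank functions $r_1$ and $r_2$. Then $$\sup\{\mu(F)\mid F\in\mathcal F_1\cap\mathcal F_2\}=\min_{X\in\Sigma}\{r_1(X)+r_2(J\setminus X)\},$$ where, in particular, the minimum on the right-hand side is attained.
   Context: A standard measure space $(J,\Sigma,\mu)$ is a standard Borel space $(J,\Sigma)$ with a finite atomless measure $\mu\colon\Sigma\to[0,\infty)$. Convention: measurable sets are identified when they differ by a $\mu$-null set: $A=B$ means $\mu(A\triangle B)=0$, $A\subseteq B$ means $\mu(A\setminus B)=0$, and families of measurable sets are families in the measure algebra (membership is unaffected by null modifications). All sets are assumed measurable. A set $X$ in a family $\mathcal X$ is maximal in $\mathcal X$ if $X\subseteq Y\in\mathcal X$ implies $Y\subseteq X$. Write $\mathcal X|Z=\{X\in\mathcal X\mid X\subseteq Z\}$. A measurable matroid $M=(J,\Sigma,\mu,\mathcal F)$ consists of a standard measure space and a family $\mathcal F\subseteq\Sigma$ (the independent sets) satisfying: (I1) $\emptyset\in\mathcal F$; (I2) $F_1\subseteq F_2\in\mathcal F$ implies $F_1\in\mathcal F$; (I3) for all $X\in\Sigma$ and all maximal $F_1,F_2\in\mathcal F|X$, $\mu(F_1)=\mu(F_2)$; (I4) if $(F_i)_{i\in\mathbb N}$ is an increasing sequence in $\mathcal F$, then $\bigcup_i F_i\in\mathcal F$. Its rank function is $r(X)=\mu(F)$ for any maximal $F\in\mathcal F|X$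 (such $F$ exists and the value does not depend on the choice). *)

(* Defs.v *)
From HB Require Import structures.
From mathcomp Require Import all_boot all_order all_algebra.
From mathcomp Require Import all_classical all_reals all_analysis.

Set Implicit Arguments.
Unset Strict Implicit.
Unset Printing Implicit Defensive.

Import Order.TTheory GRing.Theory Num.Theory.

Local Open Scope classical_set_scope.
Local Open Scope ring_scope.
Local Open Scope ereal_scope.

Definition polish_metric (R : realType) (P : metricType R) :=
  (forall F : set_system P, ProperFilter F -> cauchy F -> exists x : P, F --> x)
  /\ (exists2 D : set P, countable D & dense D).

(* [<<s @open P >>] is the Borel sigma-algebra of [P]. *)
Definition standard_borel (R : realType) (d : measure_display)
    (J : measurableType d) :=
  exists P : metricType R, polish_metric P /\
    exists f : J -> P, bijective f /\
      forall A : set J, measurable A <-> <<s @open P >> (f @` A).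

Section measurable_matroid.
Context (R : realType) (d : measure_display) (J : measurableType d).

Section families.
Variable mu : {finite_measure set J -> \bar R}.

Definition atom (A : set J) :=
  [/\ measurable A, 0 < mu A &
      forall B, measurable B -> B `<=` A -> mu B = 0 \/ mu B = mu A].

Definition standard_measure_space :=
  standard_borel R J /\ forall A, ~ atom A.

(* Inclusion in the measure algebra; used in place of [`<=`] throughout. *)
Definition ae_subset (A B : set J) := mu (A `\` B) = 0.

Definition maximal_in (F : set (set J)) (A : set J) :=
  F A /\ forall B, F B -> ae_subset A B -> ae_subset B A.

Definition restrict_family (F : set (set J)) (X : set J) : set (set J) :=
  [set A | F A /\ ae_subset A X].

(* Together [indep_measurable] and [indep_subset] make [indep] invariant under
   modification of a measurable set by a null set. *)
Record measurable_matroid := MeasurableMatroid {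
  indep : set (set J) ;
  indep_measurable : forall A, indep A -> measurable A ;
  indep0 : indep set0 ;
  indep_subset : forall A B,
    measurable A -> ae_subset A B -> indep B -> indep A ;
  indep_maximal : forall X, measurable X -> forall A B,
    maximal_in (restrict_family indep X) A ->
    maximal_in (restrict_family indep X) B -> mu A = mu B ;
  indep_bigcup : forall A : (set J)^nat, (forall i, indep (A i)) ->
    (forall i, ae_subset (A i) (A i.+1)) -> indep (\bigcup_i A i)
}.

End families.

Variable mu : {finite_measure set J -> \bar R}.

Definition rank (M : measurable_matroid mu) (X : set J) : \bar R :=
  mu (xget set0 (maximal_in mu (restrict_family mu (indep M) X))).

Lemma rankE (M : measurable_matroid mu) (X A : set J) : measurable X ->
  maximal_in mu (restrict_family mu (indep M) X) A -> rank M X = mu A.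
Proof.
move=> mX maxA; apply: (@indep_maximal _ M X mX _ _ _ maxA).
exact: xgetPex (ex_intro _ A maxA).
Qed.

End measurable_matroid.

(* Main.v *)
Require Import Defs.
From mathcomp Require Import all_boot all_order all_algebra.
From mathcomp Require Import all_classical all_reals all_analysis.
From mathcomp Require Import lra zify.

Set Implicit Arguments.
Unset Strict Implicit.
Unset Printing Implicit Defensive.

Import Order.TTheory GRing.Theory Num.Theory.
Import numFieldNormedType.Exports.

Local Open Scope classical_set_scope.
Local Open Scope ring_scope.

(** One inequality is weak duality: a common independent set [F] splits into its
    trace on [X], of measure at most the first rank of [X], and the remainder, of
    measure at most the second rank of the complement of [X].

    The converse is proved by an auction, which replaces augmenting paths by
    greedy bases. Fix a top level. Each point carries two integer levels, the second
    equal to the first or larger by one. A basis [B1] of the first matroid prefers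
    points of low first level, and a basis [B2] of the second matroid prefers points
    of high second level. Points of [B1] outside [B2] bid: they raise the second
    level to enter [B2], and if this fails they raise the first level, at the risk
    of being replaced in [B1]. Points of [B2] outside [B1] have never been bid
    upon, so they have second level zero. A point leaves [B1] or joins [B2] only
    when one of its levels rises, so the whole state is monotone and bounded at
    each point; states therefore have limits along increasing sequences
    ([state_limit]), and by exhaustion there is a state in which no bid is possible
    on a set of positive measure ([saturated_state]). In that state almost every
    point of [B1] outside [B2] is at the top level. Let [F] be the intersection of
    [B1] and [B2]. For each threshold, the set [X] of points of first level below
    it satisfies: the rank of [X] in the first matroid plus the rank of its
    complement in the second is at most the measure of [F] plus the measure of the
    points of one single level. Averaging over the thresholds makes the error
    arbitrarily small ([approximate_duality]).

    The minimum is attained because the sum of ranks is submodular and continuous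
    in [X]: the limit superior of a fast minimising sequence is a minimiser
    ([dual_value_attains]). *)

Ltac meas := repeat first
  [ assumption | exact: measurableT | exact: measurable0 | apply: measurableU
  | apply: measurableI | apply: measurableD | apply: measurableC ].
Ltac settauto := move=> ? /=; tauto.

(** * A maximality principle *)

(** The Brezis-Browder ordering principle. From each [s] move to a [t] above it
    that realises at least half of the gain still available above [s]. An upper
    bound of the resulting chain admits no further gain: any gain above it would
    be at most every single increment of a bounded sequence. *)
Lemma brezis_browder (R : realType) (T : Type) (P : set T)
    (le : T -> T -> Prop) (phi : T -> R) (K : R) :
  (forall s, le s s) -> (forall s t u, le s t -> le t u -> le s u) ->
  (forall s, P s -> phi s <= K) ->
  (forall s t, P s -> P t -> le s t -> phi s <= phi t) ->
  (forall s : nat -> T, (forall i, P (s i)) -> (forall i, le (s i) (s i.+1)) ->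
     exists2 t, P t & forall i, le (s i) t) ->
  forall a, P a ->
    exists b, [/\ P b, le a b & forall c, P c -> le b c -> phi c = phi b].
Proof.
move=> lexx le_trans phiK phi_mono chain a Pa.
pose T' := {s : T | P s}.
have step (s : T') : {t : T' | le (sval s) (sval t) /\
    forall c, P c -> le (sval s) c ->
      phi c - phi (sval t) <= phi (sval t) - phi (sval s)}.
  apply: cid; case: s => s Ps /=.
  pose V := [set phi c | c in [set c | P c /\ le s c]].
  have supV : has_sup V.
    split; first by exists (phi s), s.
    by exists K => _ [c [Pc _] <-]; exact: phiK.
  have le_supV c : P c -> le s c -> phi c <= sup V.
    by move=> Pc sc; apply: sup_upper_bound => //; exists c.
  have [e_gt0|e_le0] := ltP 0 ((sup V - phi s) / 2); last first.
    by exists (exist _ s Ps); split => //= c Pc sc; have := le_supV _ Pc sc; lra.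
  have [_ [t [Pt st] <-] tV] := sup_adherent e_gt0 supV.
  by exists (exist _ t Pt); split => //= c Pc sc; have := le_supV _ Pc sc; lra.
have [s [s0 sS]] := dependent_choice step (exist _ a Pa).
have Ps i : P (sval (s i)) by case: (s i).
have [b Pb sb] := chain (fun i => sval (s i)) Ps (fun i => (sS i).1).
exists b; split => //; first by have := sb 0; rewrite s0.
move=> c Pc bc; apply/eqP; rewrite eq_le (phi_mono _ _ Pb Pc bc) andbT.
rewrite leNgt; apply/negP => lt_bc.
(* every step gains at least [phi c - phi b], so boundedness forces this
   difference to vanish *)
have gain i : i%:R * (phi c - phi b) <= phi (sval (s i)) - phi (sval (s 0)).
  elim: i => [|i IHi]; first by rewrite mul0r subrr.
  have := (sS i).2 c Pc (le_trans _ _ _ (sb i) bc).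
  have := phi_mono _ _ (Ps i.+1) Pb (sb i.+1).
  by rewrite -natr1 mulrDl mul1r; lra.
have gt0 : 0 < phi c - phi b by rewrite subr_gt0.
have := archi_boundP (_ : 0 <= (K - phi (sval (s 0))) / (phi c - phi b)).
set N := Num.bound _.
have K0 : 0 <= K - phi (sval (s 0)) by rewrite subr_ge0 phiK.
move=> /(_ (divr_ge0 K0 (ltW gt0))); rewrite ltr_pdivrMr // => ltN.
by have := gain N; have := phiK _ (Ps N); lra.
Qed.

(** * Measures of sets as real numbers *)

Section mass.
Context (R : realType) (d : measure_display) (J : measurableType d).
Variable mu : {finite_measure set J -> \bar R}.
Implicit Types A B C X : set J.

Definition mass A : R := fine (mu A).

Lemma massE A : measurable A -> mu A = (mass A)%:E.
Proof. by move=> mA; rewrite /mass fineK // fin_num_measure. Qed.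

Lemma mass_ge0 A : 0 <= mass A.
Proof. exact/fine_ge0/measure_ge0. Qed.

Lemma mass0 : mass set0 = 0.
Proof. by rewrite /mass measure0. Qed.

Lemma mass_le A B : measurable A -> measurable B -> A `<=` B ->
  mass A <= mass B.
Proof.
move=> mA mB AB; rewrite -lee_fin -!massE //.
by apply: le_measure; rewrite ?inE.
Qed.

Lemma massU A B : measurable A -> measurable B ->
  (forall x, A x -> B x -> False) -> mass (A `|` B) = mass A + mass B.
Proof.
move=> mA mB AB; apply: EFin_inj; rewrite EFinD -!massE //; last exact: measurableU.
by rewrite measureU // -subset0 => x [] /AB.
Qed.

Lemma massDI A B : measurable A -> measurable B ->
  mass A = mass (A `\` B) + mass (A `&` B).
Proof.
move=> mA mB; rewrite -massU; [|by meas|by meas|settauto].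
by congr mass; apply/seteqP; split=> x /=; have := pselect (B x); tauto.
Qed.

Lemma massUD A B : measurable A -> measurable B ->
  mass (A `|` B) = mass A + mass (B `\` A).
Proof.
move=> mA mB; rewrite -massU; [|by meas|by meas|settauto].
by congr mass; apply/seteqP; split=> x /=; have := pselect (A x); tauto.
Qed.

Lemma mass_leU A B : measurable A -> measurable B ->
  mass (A `|` B) <= mass A + mass B.
Proof.
move=> mA mB; rewrite massUD // lerD2l; apply: mass_le; [by meas|by meas|].
settauto.
Qed.

Lemma mass_le_null A B : measurable A -> measurable B -> mass (A `\` B) = 0 ->
  mass A <= mass B.
Proof.
move=> mA mB AB0; rewrite (massDI mA mB) AB0 add0r.
by apply: mass_le; [by meas|by meas|settauto].
Qed.

Lemma ae_subsetP A B : measurable A -> measurable B ->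
  ae_subset mu A B <-> mass (A `\` B) = 0.
Proof.
move=> mA mB; rewrite /ae_subset massE; last by meas.
by split => [[]|->].
Qed.

Lemma subset_ae A B : A `<=` B -> ae_subset mu A B.
Proof. by move=> AB; rewrite /ae_subset (_ : A `\` B = set0) ?measure0 // -subset0 => x [/AB]. Qed.

Lemma null_subset A B : measurable A -> measurable B -> A `<=` B ->
  mass B = 0 -> mass A = 0.
Proof.
move=> mA mB AB B0; apply/eqP; rewrite eq_le mass_ge0 andbT -B0.
exact: mass_le.
Qed.

(** Along a sequence of sets whose membership is eventually constant at each
    point, the symmetric differences with the limit are contained in a sequence
    of tail unions that decreases to the empty set. *)
Lemma mass_ptwise_cvg (A : nat -> set J) B :
  (forall k, measurable (A k)) -> measurable B ->
  (forall x, exists K, forall k, (K <= k)%N -> A k x <-> B x) ->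
  forall e : R, 0 < e ->
    exists K, forall k, (K <= k)%N ->
      mass (A k `\` B) <= e /\ mass (B `\` A k) <= e.
Proof.
move=> mA mB AB e e_gt0.
pose E k := \bigcup_(j in [set j | (k <= j)%N]) ((A j `\` B) `|` (B `\` A j)).
have mE k : measurable (E k) by apply: bigcup_measurable => j _; meas.
have E0 : \bigcap_k E k = set0.
  rewrite -subset0 => x Ex; have [K AK] := AB x.
  by have [j /= Kj] := Ex K I; have := AK j Kj; tauto.
have Ecvg : (mu \o E) k @[k --> \oo] --> mu (\bigcap_k E k).
  apply: nonincreasing_cvg_mu => //.
  - by rewrite ltey_eq fin_num_measure.
  - by rewrite E0.
  - move=> i j ij; apply/subsetPset => x [k /= jk Ek].
    by exists k => //=; apply: leq_trans jk.
have : \forall k \near \oo, (fine \o (mu \o E)) k < e.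
  by apply: cvgr_lt e_gt0; apply: fine_cvg; rewrite E0 measure0 in Ecvg.
move=> [K _ muK]; exists K => k Kk.
split; apply: le_trans (ltW (muK k Kk)); apply: mass_le => //; try by meas.
  by move=> x ABx; exists k => //=; left.
by move=> x ABx; exists k => //=; right.
Qed.
End mass.

(** * The rank function *)

Section rank.
Context (R : realType) (d : measure_display) (J : measurableType d).
Context (mu : {finite_measure set J -> \bar R}) (M : measurable_matroid mu).
Implicit Types A B C X Y F : set J.
Local Notation mass := (mass mu).

Definition rk X : R := fine (rank M X).

(** By [indep_bigcup] unions of chains are independent, so a maximal independent
    superset exists by exhaustion; by [indep_maximal] its measure is the rank. *)
Lemma basis_extend X F : measurable X -> indep M F -> F `<=` X ->
  exists G, [/\ indep M G, F `<=` G, G `<=` X & mass G = rk X].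
Proof.
move=> mX iF FX; have mF := indep_measurable iF.
have [||B [iB BX]|A B [/indep_measurable mA _] [/indep_measurable mB _]|S iS SS|
  |G [[iG GX] FG Gmax]] := @brezis_browder R (set J)
  [set A | indep M A /\ A `<=` X] (fun A B => A `<=` B) mass (mass X)
  _ _ _ _ _ F _.
- by move=> A x.
- by move=> A B C; exact: subset_trans.
- by apply: mass_le => //; exact: indep_measurable iB.
- exact: mass_le.
- exists (\bigcup_i S i) => [|i]; last exact: bigcup_sup.
  split; last by apply: bigcup_sub => i _; exact: (iS i).2.
  by apply: indep_bigcup => i; [exact: (iS i).1|exact/subset_ae/SS].
- by [].
have mG := indep_measurable iG.
exists G; split => //; rewrite /rk (@rankE _ _ _ _ _ _ G) //.
split; first by split => //; exact: subset_ae.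
move=> B [iB BX] GB; have mB := indep_measurable iB.
move: BX GB => /ae_subsetP BX /ae_subsetP GB; apply/ae_subsetP => //.
(* [G] is maximal for inclusion as sets, so it is compared with a genuine
   superset that agrees with [B] up to null sets *)
have iC : indep M (G `|` (B `&` X)).
  apply: indep_subset iB; [by meas|apply/ae_subsetP; [by meas|by meas|]].
  apply: null_subset (GB mG mB); [by meas|by meas|settauto].
have /Gmax : [set A | indep M A /\ A `<=` X] (G `|` (B `&` X)).
  by split => // x /= [/GX|[]].
rewrite massUD; [|by meas|by meas].
move=> /(_ (@subsetUl _ _ _)) C0.
have BX0 := BX mB mX.
apply/eqP; rewrite eq_le mass_ge0 andbT.
apply: (@le_trans _ _ (mass ((B `\` X) `|` ((B `&` X) `\` G)))).
  apply: mass_le; [by meas|by meas|].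
  by move=> x /=; have := pselect (X x); tauto.
apply: le_trans (mass_leU _ _ _) _; [by meas|by meas|lra].
Qed.

Lemma basis_exists X : measurable X ->
  exists G, [/\ indep M G, G `<=` X & mass G = rk X].
Proof.
move=> mX; have [G [? _ ? ?]] := basis_extend mX (indep0 M) (@sub0set _ X).
by exists G.
Qed.

Lemma indep_le_rk X F : measurable X -> indep M F -> F `<=` X ->
  mass F <= rk X.
Proof.
move=> mX iF FX; have [G [iG FG _ <-]] := basis_extend mX iF FX.
by apply: mass_le => //; [exact: indep_measurable iF|exact: indep_measurable iG].
Qed.

Lemma rk_le_mass X : measurable X -> rk X <= mass X.
Proof.
move=> mX; have [G [iG GX <-]] := basis_exists mX.
by apply: mass_le => //; exact: indep_measurable iG.
Qed.

Lemma rk_mono X Y : measurable X -> measurable Y -> X `<=` Y -> rk X <= rk Y.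
Proof.
move=> mX mY XY; have [G [iG GX <-]] := basis_exists mX.
by apply: indep_le_rk => //; exact: subset_trans XY.
Qed.

(** Independence thus becomes an equation between two functions that are
    continuous along pointwise convergence, so it passes to limits. *)
Lemma indepP X : measurable X -> indep M X <-> rk X = mass X.
Proof.
move=> mX; split=> [iX|rX].
  by apply/eqP; rewrite eq_le rk_le_mass //= indep_le_rk.
have [G [iG GX mGE]] := basis_exists mX; have mG := indep_measurable iG.
apply: indep_subset (iG) => //; apply/ae_subsetP => //.
have := massDI mu mX mG; rewrite (_ : X `&` G = G); first lra.
by apply/seteqP; split=> x /=; have := GX x; tauto.
Qed.

Lemma rk0 : rk set0 = 0.
Proof. by rewrite (indepP measurable0).1 ?mass0 //; exact: indep0. Qed.

(** This is the Lipschitz property of the rank with respect to the measure of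
    symmetric differences. *)
Lemma rk_leD X Y : measurable X -> measurable Y ->
  rk X <= rk Y + mass (X `\` Y).
Proof.
move=> mX mY; have [G [iG GX <-]] := basis_exists mX.
have mG := indep_measurable iG.
rewrite (massDI mu mG mY) addrC lerD //; last first.
  by apply: mass_le; [by meas|by meas|move=> x [/GX]].
apply: indep_le_rk => //; apply: indep_subset (iG); first by meas.
by apply: subset_ae.
Qed.

(** A basis of the intersection, extended to a basis [G] of the union, meets
    [X] and [Y] in independent sets, and the sum of the measures of these is
    [mass G] plus the measure of [G `&` X `&` Y]. *)
Lemma rk_submod X Y : measurable X -> measurable Y ->
  rk (X `|` Y) + rk (X `&` Y) <= rk X + rk Y.
Proof.
move=> mX mY.
have [B [iB BI <-]] := basis_exists (measurableI _ _ mX mY).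
have mB := indep_measurable iB.
have [|G [iG BG GU <-]] := basis_extend (measurableU _ _ mX mY) iB.
  by move=> x /BI []; left.
have mG := indep_measurable iG.
have iGI Z : measurable Z -> mass (G `&` Z) <= rk Z.
  move=> mZ; apply: indep_le_rk => //; apply: indep_subset (iG); first by meas.
  exact: subset_ae.
have := iGI X mX; have := iGI Y mY.
have : mass B <= mass (G `&` X `&` Y).
  by apply: mass_le; [by meas|by meas|move=> x Bx; have [] := BI _ Bx; split; [split; [apply: BG|]|]].
have := massDI mu mG mX; have := massDI mu (measurableI _ _ mG mY) mX.
have -> : G `&` Y `&` X = G `&` X `&` Y by apply/seteqP; split; settauto.
have -> : G `&` Y `\` X = G `\` X.
  by apply/seteqP; split=> x /=; have := GU x => /=; tauto.
lra.
Qed.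

(** All the invariants of the auction below have the form [mass A = rk B]; this is
    what makes the class of auction states closed under limits. *)
Lemma rk_mass_cvg (A B : nat -> set J) A' B' :
  (forall k, measurable (A k)) -> measurable A' ->
  (forall k, measurable (B k)) -> measurable B' ->
  (forall x, exists K, forall k, (K <= k)%N ->
    (A k x <-> A' x) /\ (B k x <-> B' x)) ->
  (forall k, mass (A k) = rk (B k)) -> mass A' = rk B'.
Proof.
move=> mA mA' mB mB' cvgAB AB.
have cvgA x : exists K, forall k, (K <= k)%N -> A k x <-> A' x.
  by have [K HK] := cvgAB x; exists K => k /HK [].
have cvgB x : exists K, forall k, (K <= k)%N -> B k x <-> B' x.
  by have [K HK] := cvgAB x; exists K => k /HK [].
apply/eqP; rewrite -subr_eq0 -normr_le0; apply/ler_addgt0Pr => e e_gt0.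
have e2 : 0 < e / 2 by lra.
have [K1 HK1] := mass_ptwise_cvg mu mA mA' cvgA e2.
have [K2 HK2] := mass_ptwise_cvg mu mB mB' cvgB e2.
have [] := HK1 _ (leq_maxl K1 K2); have [] := HK2 _ (leq_maxr K1 K2).
set k := maxn K1 K2.
have := rk_leD (mB k) mB'; have := rk_leD mB' (mB k).
have := massDI mu (mA k) mA'; have := massDI mu mA' (mA k).
rewrite (setIC A') => ? ? ? ? ? ? ? ?; have ABk := AB k.
have := mass_ge0 mu (A k `\` A'); have := mass_ge0 mu (A' `\` A k) => ? ?.
by rewrite ler_norml; apply/andP; split; lra.
Qed.
End rank.

(** * Greedy bases *)

Section greedy.
Context (R : realType) (d : measure_display) (J : measurableType d).
Context (mu : {finite_measure set J -> \bar R}) (M : measurable_matroid mu).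
Implicit Types A B X Y Z : set J.
Local Notation mass := (mass mu).
Local Notation rk := (rk M).

(** A basis of [L i] extends to a basis of [L i.+1], whose trace on [L i] cannot
    exceed the rank of [L i]. *)
Lemma greedy_basis (L : nat -> set J) (m : nat) :
  (forall i, measurable (L i)) -> (forall i, L i `<=` L i.+1) ->
  exists B, [/\ indep M B, B `<=` L m &
    forall i, (i <= m)%N -> mass (B `&` L i) = rk (L i)].
Proof.
move=> mL sL; elim: m => [|m [B [iB BL IHm]]].
  have [G [iG GL rG]] := basis_exists M (mL 0).
  by exists G; split => // i; rewrite leqn0 => /eqP ->; rewrite (setIidl GL).
have [G [iG BG GL rG]] := basis_extend (mL m.+1) iB (subset_trans BL (sL m)).
have mG := indep_measurable iG; have mB := indep_measurable iB.
exists G; split => // i; rewrite leq_eqVlt => /predU1P[->|].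
  by rewrite (setIidl GL).
rewrite ltnS => im; apply/eqP; rewrite eq_le; apply/andP; split.
  apply: indep_le_rk; [by []| |by move=> x []].
  by apply: indep_subset (iG); [by meas|apply: subset_ae => x []].
by rewrite -(IHm i im); apply: mass_le; [by meas|by meas|exact: setSI].
Qed.

(** [B `&` U] spans [U] by the equation on ranks, so a set [Z] that contains it
    spans [U] as well. *)
Lemma rk_spanU U B Z : measurable U -> measurable B -> measurable Z ->
  indep M B -> mass (B `&` U) = rk U -> B `&` U `<=` Z ->
  rk (U `|` Z) <= rk Z.
Proof.
move=> mU mB mZ iB rU BUZ.
have : rk U <= rk (U `&` Z).
  rewrite -rU; apply: indep_le_rk; [by meas| |by move=> x [? ?]; split => //; apply: BUZ].
  by apply: indep_subset (iB); [by meas|apply: subset_ae => x []].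
by have := rk_submod M mU mZ; lra.
Qed.

(** The part [Z] of [B] outside [X] is free over [X] since [B `&` X] spans [X];
    by submodularity it stays free over every subset [Y] of [X]. *)
Lemma rk_extend_free X Y B Z : measurable X -> measurable Y -> measurable B ->
  measurable Z -> indep M B -> mass (B `&` X) = rk X -> Y `<=` X ->
  Z `<=` B -> (forall x, X x -> Z x -> False) ->
  rk Y + mass Z <= rk (Y `|` Z).
Proof.
move=> mX mY mB mZ iB rX YX ZB XZ.
have mYZ : measurable (Y `|` Z) by meas.
have : rk X + mass Z <= rk (X `|` Z).
  rewrite -rX -massU; [|by meas|by meas|by move=> x [_ Xx] /(XZ _ Xx)].
  apply: indep_le_rk; [by meas| |settauto].
  apply: indep_subset (iB); first by meas.
  by apply: subset_ae => x /= []; [case|exact: ZB].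
have := rk_submod M mYZ mX.
have -> : (Y `|` Z) `&` X = Y.
  apply/seteqP; split=> x /=; last by move=> /[dup] /YX; tauto.
  by have := XZ x; tauto.
have -> : Y `|` Z `|` X = X `|` Z.
  by apply/seteqP; split=> x /=; have := YX x => /=; tauto.
lra.
Qed.
End greedy.

Section finite_families.
Context (R : realType) (d : measure_display) (J : measurableType d).
Context (mu : {finite_measure set J -> \bar R}).
Local Notation mass := (mass mu).

Lemma mass_le_cover N (D : nat -> set J) A :
  (forall i, measurable (D i)) -> measurable A ->
  (forall x, A x -> exists2 i, (i < N)%N & D i x) ->
  mass A <= \sum_(i < N) mass (D i).
Proof.
move=> mD; elim: N A => [|N IHN] A mA AD.
  rewrite big_ord0 (_ : A = set0) ?mass0 // -subset0 => x /AD [] //.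
rewrite big_ord_recr /= (massDI mu mA (mD N)) lerD //.
  apply: IHN; first by meas.
  move=> x [/AD [i]]; rewrite ltnS leq_eqVlt => /predU1P[->//|iN Dx _].
  by exists i.
by apply: mass_le; [by meas|by meas|settauto].
Qed.

Lemma sum_mass_le N (f : J -> nat) :
  (forall i, measurable [set x | f x = i]) ->
  \sum_(i < N) mass [set x | f x = i] <= mass [set: J].
Proof.
move=> mf.
have mfN k : measurable [set x | (f x < k)%N].
  rewrite (_ : mkset _ = \bigcup_(i in [set i | (i < k)%N]) [set x | f x = i]).
    exact: bigcup_measurable.
  by apply/seteqP; split=> x /=; [exists (f x)|move=> [i /= ik ->]].
apply: (@le_trans _ _ (mass [set x | (f x < N)%N])); last exact: mass_le.
elim: N => [|N IHN]; first by rewrite big_ord0 mass_ge0.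
rewrite big_ord_recr /= (_ : [set x | (f x < N.+1)%N] =
  [set x | (f x < N)%N] `|` [set x | f x = N]).
  by rewrite massU ?lerD // => x /= /[swap] ->; rewrite ltnn.
apply/seteqP; split=> x /=.
  by rewrite ltnS leq_eqVlt => /predU1P[]; [right|left].
by case=> [|->]; rewrite ltnS // => /ltnW.
Qed.
End finite_families.

(** * The auction *)

Lemma nat_stationary (f : nat -> nat) N :
  (forall k, (f k <= f k.+1)%N) -> (forall k, (f k <= N)%N) ->
  exists K, forall k, (K <= k)%N -> f k = f K.
Proof.
move=> f_incr fN.
have exP : exists m, `[< exists k, f k = m >] by exists (f 0); apply/asboolP; exists 0.
have ubP m : `[< exists k, f k = m >] -> (m <= N)%N by move=> /asboolP[k <-].
case: (ex_maxnP exP ubP) => m /asboolP[K <-] maxK; exists K => k Kk.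
apply/eqP; rewrite eqn_leq maxK; last by apply/asboolP; exists k.
by rewrite /=; elim: k Kk => [|k IHk]; rewrite ?leqn0; [move=> /eqP ->|
  rewrite leq_eqVlt => /predU1P[->//|/IHk /leq_trans]; apply].
Qed.

(** The position of a point in the auction: the first component is twice its level
    on the side of the first matroid, plus one if the point lies in the current
    basis [B1] of that matroid; the second component is twice its level on the side
    of the second matroid, plus one if the point lies outside the current basis
    [B2]. With this encoding the allowed moves are exactly the increases of the two
    components: a point may join [B1] or leave [B2] at any time, but it may leave
    [B1] or join [B2] only when the corresponding level rises. *)
Definition code := (nat * nat)%type.
Definition lvl1 (c : code) : nat := c.1./2.
Definition in1 (c : code) : bool := odd c.1.
Definition lvl2 (c : code) : nat := c.2./2.
Definition in2 (c : code) : bool := ~~ odd c.2.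
Definition code_le (c e : code) := ((c.1 <= e.1) && (c.2 <= e.2))%N.
Definition total (c : code) : nat := (c.1 + c.2)%N.

(** The last clause says that a point of [B2] outside [B1] has never been bid
    upon. *)
Definition valid_code n (c : code) :=
  [&& (lvl1 c <= lvl2 c <= (lvl1 c).+1)%N, (lvl2 c <= n)%N &
      in2 c ==> (in1 c || (lvl2 c == 0%N))].

Section auction_states.
Context (R : realType) (d : measure_display) (J : measurableType d).
Context (mu : {finite_measure set J -> \bar R}) (M1 M2 : measurable_matroid mu).
Variable n : nat.
Local Notation mass := (mass mu).

Definition region (s : J -> code) (p : pred code) : set J := [set x | p (s x)].

(** By [st_greedy1] the basis [B1] prefers low levels: it contains a basis of each
    sublevel set. By [st_greedy2] the basis [B2] prefers high levels: it contains a
    basis of each superlevel set. *)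
Record auction_state (s : J -> code) : Prop := AuctionState {
  st_measurable : forall c, measurable [set x | s x = c] ;
  st_valid : forall x, valid_code n (s x) ;
  st_indep1 : mass (region s in1) = rk M1 (region s in1) ;
  st_indep2 : mass (region s in2) = rk M2 (region s in2) ;
  st_greedy1 : forall i, (i <= n.+1)%N ->
    mass (region s [pred c | in1 c & (lvl1 c < i)%N]) =
    rk M1 (region s [pred c | (lvl1 c < i)%N]) ;
  st_greedy2 : forall i, (i <= n)%N ->
    mass (region s [pred c | in2 c & (i <= lvl2 c)%N]) =
    rk M2 (region s [pred c | (i <= lvl2 c)%N])
}.

Definition state_le (s t : J -> code) := forall x, code_le (s x) (t x).

Lemma measurable_region s p : (forall c, measurable [set x | s x = c]) ->
  measurable (region s p).
Proof.
move=> ms; rewrite (_ : region s p =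
    \bigcup_(c in [set: code]) ([set x | s x = c] `&` [set _ | p c])).
  apply: countable_bigcupT_measurable => [|c]; first exact: countableP.
  apply: measurableI => //; case: (p c).
    by rewrite (_ : [set _ | _] = setT) //; apply/seteqP; split.
  by rewrite (_ : [set _ | _] = set0) //; apply/seteqP; split.
by apply/seteqP; split=> x; [exists (s x)|move=> [c _ [/= <-]]].
Qed.

Lemma measurable_update s (B : set J) (f : code -> bool -> code) :
  (forall c, measurable [set x | s x = c]) -> measurable B ->
  forall c, measurable [set x | f (s x) `[< B x >] = c].
Proof.
move=> ms mB c.
rewrite (_ : mkset _ = (B `&` region s [pred e | f e true == c]) `|`
    (~` B `&` region s [pred e | f e false == c])).
  have mw := measurable_region _ ms.
  by apply: measurableU; apply: measurableI => //; exact: measurableC.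
apply/seteqP; split=> x /=.
  by case: asboolP => Bx /eqP; [left|right].
by case=> -[Bx /eqP]; case: asboolP.
Qed.

Lemma total_le s x : auction_state s -> (total (s x) < (4 * n).+3)%N.
Proof.
move=> /st_valid/(_ x) /and3P[/andP[]]; rewrite /total /lvl1 /lvl2.
have := odd_double_half (s x).1; have := odd_double_half (s x).2.
by move: (odd _) (odd _) => [] []; lia.
Qed.

(** The codes are bounded, so an increasing sequence of states is eventually
    constant at each point. *)
Lemma state_limit (s : nat -> J -> code) :
  (forall k, auction_state (s k)) -> (forall k, state_le (s k) (s k.+1)) ->
  exists2 t, auction_state t & forall k, state_le (s k) t.
Proof.
move=> st_s s_incr.
have s_homo x k l : (k <= l)%N -> code_le (s k x) (s l x).
  elim: l => [|l IHl]; first by rewrite leqn0 => /eqP ->; rewrite /code_le !leqnn.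
  rewrite leq_eqVlt => /predU1P[->|]; first by rewrite /code_le !leqnn.
  rewrite ltnS => /IHl /andP[le1 le2]; have /andP[le1' le2'] := s_incr l x.
  by rewrite /code_le (leq_trans le1) ?(leq_trans le2).
have stab x : {K | forall k, (K <= k)%N -> s k x = s K x}.
  apply: cid; have [|k|K HK] := @nat_stationary (fun k => total (s k x)) (4 * n).+2.
  - by move=> k; have /andP[? ?] := s_incr k x; apply: leq_add.
  - by have := total_le x (st_s k).
  exists K => k Kk; have /andP[] := s_homo x _ _ Kk; have := HK _ Kk.
  by rewrite /total; move: (s k x) (s K x) => [a b] [a' b'] /=; move=> ? ? ?; congr pair; lia.
pose t x := s (sval (stab x)) x.
have t_lim x k : (sval (stab x) <= k)%N -> s k x = t x by exact: (svalP (stab x)).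
have mt c : measurable [set x | t x = c].
  rewrite (_ : mkset _ =
    \bigcup_K \bigcap_(k in [set k | (K <= k)%N]) [set x | s k x = c]).
    apply: bigcupT_measurable => K; apply: bigcap_measurable; first by exists K => /=.
    by move=> k _; exact: st_measurable (st_s k) c.
  apply/seteqP; split=> x /=.
    by move=> <-; exists (sval (stab x)) => // k /= /t_lim.
  by move=> [K _ HK]; rewrite -(t_lim _ _ (leq_maxr K _)) HK //= leq_maxl.
have lim (M : measurable_matroid mu) (p q : pred code) :
    (forall k, mass (region (s k) p) = rk M (region (s k) q)) ->
    mass (region t p) = rk M (region t q).
  apply: rk_mass_cvg; try by move=> *; apply: measurable_region => // c;
    exact: st_measurable (st_s _) c.
  by move=> x; exists (sval (stab x)) => k /t_lim; rewrite /region /= => ->.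
exists t; last first.
  by move=> k x; rewrite -(t_lim _ _ (leq_maxr k _)); apply: s_homo; exact: leq_maxl.
split => //.
- by move=> x; exact: st_valid (st_s _) x.
- by apply: lim => k; exact: st_indep1 (st_s k).
- by apply: lim => k; exact: st_indep2 (st_s k).
- by move=> i ni; apply: lim => k; exact: st_greedy1 (st_s k) i ni.
- by move=> i ni; apply: lim => k; exact: st_greedy2 (st_s k) i ni.
Qed.

Lemma initial_state : exists s, auction_state s.
Proof.
have [B1 [iB1 _ rB1]] := basis_exists M1 (@measurableT _ J).
have [B2 [iB2 _ rB2]] := basis_exists M2 (@measurableT _ J).
have mB1 := indep_measurable iB1; have mB2 := indep_measurable iB2.
pose s x : code := (`[< B1 x >] : nat, ~~ `[< B2 x >] : nat).
have s1 : region s in1 = B1.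
  by apply/seteqP; split=> x; rewrite /region /in1 /= oddb => /asboolP.
have s2 : region s in2 = B2.
  by apply/seteqP; split=> x; rewrite /region /in2 /= oddb negbK => /asboolP.
have lvl0 x : lvl1 (s x) = 0%N /\ lvl2 (s x) = 0%N.
  by rewrite /lvl1 /lvl2 /s /=; do 2 case: `[< _ >].
have lvl10 x := (lvl0 x).1; have lvl20 x := (lvl0 x).2.
have w0 (p : pred code) : (forall x, ~~ p (s x)) -> region s p = set0.
  by move=> ps; rewrite -subset0 => x; rewrite /region /= (negPf (ps x)).
have wT (p : pred code) : (forall x, p (s x)) -> region s p = setT.
  by move=> ps; apply/seteqP; split=> // x _; exact: ps.
exists s; split.
- pose s0 := fun _ : J => (0, 0)%N : code.
  have ms0 c : measurable [set x | s0 x = c].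
    by have [<-|/eqP cN0] := eqVneq (0, 0)%N c; [rewrite (_ : mkset _ = setT)|
      rewrite (_ : mkset _ = set0)] => //; apply/seteqP; split.
  have ms1 := measurable_update (fun c b => (b : nat, 0)%N) ms0 mB1.
  exact: measurable_update (fun c b => (c.1, (~~ b : nat))) ms1 mB2.
- by move=> x; rewrite /valid_code lvl10 lvl20 /= eqxx orbT implybT.
- by rewrite s1 (indepP _ mB1).1.
- by rewrite s2 (indepP _ mB2).1.
- case=> [|i] _.
    by rewrite !w0 ?mass0 ?rk0 // => x; rewrite /= ltn0 ?andbF.
  rewrite (@wT [pred c | (lvl1 c < i.+1)%N]) => [|x]; last by rewrite /= lvl10.
  rewrite -rB1 -s1; congr mass.
  by apply/seteqP; split=> x; rewrite /region /= lvl10 andbT.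
- case=> [|i] _.
    rewrite (@wT [pred c | (0 <= lvl2 c)%N]) // -rB2 -s2; congr mass.
    by apply/seteqP; split=> x; rewrite /region /= andbT.
  by rewrite !w0 ?mass0 ?rk0 // => x; rewrite /= lvl20 ?andbF.
Qed.
End auction_states.

Section bidding.
Context (R : realType) (d : measure_display) (J : measurableType d).
Context (mu : {finite_measure set J -> \bar R}) (M1 M2 : measurable_matroid mu).
Variable n : nat.
Local Notation mass := (mass mu).
Local Notation auction_state := (auction_state M1 M2 n).

(** The points of [B1] outside [B2] whose two levels are equal all raise their
    second level. The new [B2] is a greedy basis inside the union of the old [B2]
    with the raised points; that union still spans every superlevel set. Hence
    only raised points join [B2]. *)
Lemma raise2 s : auction_state s -> exists t, [/\ auction_state t,
  state_le s t & forall x, region s [pred c | [&& in1 c, ~~ in2 c,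
    (lvl1 c < n)%N & lvl2 c == lvl1 c]] x -> (total (s x) < total (t x))%N].
Proof.
move=> st_s; have ms := measurable_region _ (st_measurable st_s).
pose a c := [&& in1 c, ~~ in2 c, (lvl1 c < n)%N & lvl2 c == lvl1 c].
pose up c := (a c + lvl2 c)%N.
pose L i := region s [pred c | (in2 c || a c) && (n - i <= up c)%N].
have [||B [iB BL rB]] := @greedy_basis _ _ _ _ M2 L n.
- by move=> i; exact: ms.
- by move=> i x /= /andP[Wx up_x]; rewrite /L /region /= Wx /=; apply: leq_trans up_x; lia.
have mB := indep_measurable iB.
pose f (c : code) (b : bool) : code := (c.1, ~~ b + (up c).*2)%N.
pose t x := f (s x) `[< B x >].
have t_in1 x : in1 (t x) = in1 (s x) by [].
have t_lvl1 x : lvl1 (t x) = lvl1 (s x) by [].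
have t_in2 x : in2 (t x) = `[< B x >].
  by rewrite /in2 /= oddD odd_double addbF oddb negbK.
have t_lvl2 x : lvl2 (t x) = up (s x) by rewrite /lvl2 /= half_bit_double.
have BW x : B x -> in2 (s x) || a (s x) by move=> /BL /andP[].
have tB : region t in2 = B.
  by apply/seteqP; split=> x; rewrite /region /= t_in2 => /asboolP.
exists t; split.
- split.
  + exact: measurable_update (st_measurable st_s) mB.
  + move=> x; have := st_valid st_s x; rewrite /valid_code t_in1 t_lvl1 t_in2 t_lvl2.
    have := BW x; rewrite /up.
    have [Bx /(_ Bx)|Bx _] := asboolP (B x); rewrite /a.
      by case: (in1 _) (in2 _) => [] [] //=; lia.
    by case: (in1 _) (in2 _) => [] [] //=; lia.
  + exact: st_indep1 st_s.
  + by rewrite tB (indepP _ mB).1.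
  + exact: st_greedy1 st_s.
  + move=> i ni.
    have -> : region t [pred c | in2 c & (i <= lvl2 c)%N] = B `&` L (n - i)%N.
      apply/seteqP; split=> x; rewrite /L /region /= t_in2 t_lvl2 subKn //.
        by move=> /andP[/asboolP Bx ->]; rewrite BW.
      by move=> [Bx /andP[_ ->]]; rewrite andbT; apply/asboolP.
    rewrite rB ?leq_subr //; apply/eqP; rewrite eq_le; apply/andP; split.
      apply: rk_mono; [exact: ms| |].
        by apply: measurable_region; exact: measurable_update (st_measurable st_s) mB.
      by move=> x; rewrite /L /region /= t_lvl2 subKn // => /andP[].
    apply: le_trans (rk_spanU (ms [pred c | (i <= lvl2 c)%N]) (ms in2) (ms _) _ _ _).
    * apply: rk_mono; [|by apply: measurableU; exact: ms|].
        by apply: measurable_region; exact: measurable_update (st_measurable st_s) mB.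
      move=> x; rewrite /region /= t_lvl2 subKn // => iup.
      have [ax|/negPf ax] := boolP (a (s x)); [right|left].
        by rewrite orbT.
      by move: iup; rewrite /up ax.
    * by apply/indepP; [exact: ms|rewrite (st_indep2 st_s)].
    * rewrite -(st_greedy2 st_s ni); congr mass.
      by apply/seteqP; split=> x; rewrite /region /=; [case=> -> ->|move=> /andP[]].
    * move=> x; rewrite /region /= subKn // => -[-> /= /leq_trans]; apply.
      exact: leq_addl.
- move=> x; rewrite /code_le /= leqnn /=.
  have := odd_double_half (s x).2; rewrite -/(lvl2 _) /up.
  have := BW x; rewrite /a /in2.
  have [Bx /(_ Bx)|Bx _] := asboolP (B x).
    by case: (in1 _) (odd _) => [] [] //=; lia.
  by case: (in1 _) (odd _) => [] [] //=; lia.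
- move=> x ax; have {}ax : a (s x) by [].
  rewrite /total /= ltn_add2l /up ax.
  have := odd_double_half (s x).2; rewrite -/(lvl2 _).
  by case: (odd _) (`[< _ >]) => [] [] /=; lia.
Qed.

(** The points of [B1] outside [B2] whose second level is already above the first
    raise their first level. The new [B1] is a greedy basis that, within each
    level, gives priority to the unraised points of the old [B1]. These are free
    over the new lower levels, which are contained in the old ones, so all of them
    are kept, up to a null set that is then added back. *)
Lemma raise1 s : auction_state s -> exists t, [/\ auction_state t,
  state_le s t & forall x, region s [pred c | [&& in1 c, ~~ in2 c,
    (lvl1 c < n)%N & lvl2 c == (lvl1 c).+1]] x -> (total (s x) < total (t x))%N].
Proof.
move=> st_s; have ms := measurable_region _ (st_measurable st_s).
pose a c := [&& in1 c, ~~ in2 c, (lvl1 c < n)%N & lvl2 c == (lvl1 c).+1].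
pose up c := (a c + lvl1 c)%N.
pose kept c := in1 c && ~~ a c.
(* [L i.*2] is the new sublevel set below [i], and [L i.*2.+1] adds to it the
   kept points of new level [i] *)
pose L k := region s [pred c | (~~ kept c + (up c).*2 < k)%N].
have [||B [iB BL rB]] := @greedy_basis _ _ _ _ M1 L (n.+1).*2.
- by move=> i; exact: ms.
- by move=> k x; rewrite /L /region /= => /ltnW.
have mB := indep_measurable iB.
pose P := region s kept; have mP : measurable P by exact: ms.
have Leven i : L i.*2 = region s [pred c | (up c < i)%N].
  apply/seteqP; split=> x; rewrite /L /region /=; case: (kept _) => /=; lia.
have Lodd i : L i.*2.+1 = L i.*2 `|` region s [pred c | kept c & up c == i].
  apply/seteqP; split=> x; rewrite /L /region /=; case: (kept _) => /=.
  - by have [->|] := eqVneq (up (s x)) i; [right|left; lia].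
  - by left; lia.
  - by case=> [|/eqP ->]; lia.
  - by case=> //; lia.
have up_n x : (up (s x) <= n)%N.
  have := st_valid st_s x; rewrite /up /a /valid_code.
  by case: (in1 _) (in2 _) => [] [] //=; lia.
have null i : (i <= n)%N ->
    mass (region s [pred c | kept c & up c == i] `\` B) = 0.
  move=> ni; set Z := region s _; pose Y := region s [pred c | (up c < i)%N].
  have mZ : measurable Z by exact: ms.
  have mY : measurable Y by exact: ms.
  have : rk M1 Y + mass Z <= rk M1 (Y `|` Z).
    apply: (@rk_extend_free _ _ _ _ _ (region s [pred c | (lvl1 c < i)%N]) _
      (region s in1)) => //; try exact: ms.
    - by apply/indepP; [exact: ms|rewrite (st_indep1 st_s)].
    - rewrite -(st_greedy1 st_s (leqW ni)); congr mass.
      by apply/seteqP; split=> x; rewrite /region /=; [case=> -> ->|move=> /andP[]].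
    - by move=> x; apply: leq_ltn_trans; exact: leq_addl.
    - by move=> x /andP[/andP[]].
    - move=> x; rewrite /Z /region /= /kept /up => vi /andP[/andP[_ /negPf ->]].
      by rewrite add0n => /eqP vE; rewrite vE ltnn in vi.
  have := rB i.*2; have := rB i.*2.+1; rewrite Lodd Leven -/Y -/Z.
  have -> : (i.*2.+1 <= n.+1.*2)%N by lia.
  have -> : (i.*2 <= n.+1.*2)%N by lia.
  move=> /(_ isT) <- /(_ isT) <-.
  rewrite setIUr massU; [|by meas|by meas|]; last first.
    move=> x [_]; rewrite /Y /Z /region /= => up_lt [_ /andP[_ /eqP upE]].
    by rewrite upE ltnn in up_lt.
  have := massDI mu mZ mB; have := mass_ge0 mu (Z `\` B); rewrite (setIC B Z).
  by move=> *; lra.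
(* the greedy choice keeps all of [P] up to a null set *)
have PB0 : mass (P `\` B) = 0.
  apply/eqP; rewrite eq_le mass_ge0 andbT.
  apply: (@le_trans _ _ (\sum_(i < n.+1)
      mass (region s [pred c | kept c & up c == i] `\` B))).
    apply: (@mass_le_cover _ _ _ _ _ (fun i =>
        region s [pred c | kept c & up c == i] `\` B)).
    - by move=> i; apply: measurableD => //; exact: ms.
    - by meas.
    - move=> x [Px nBx]; exists (up (s x)); first by rewrite ltnS.
      by split => //; rewrite /region /= eqxx andbT.
  by rewrite big1 // => i _; apply: null; rewrite -ltnS.
pose f (c : code) (b : bool) : code := ((b || kept c) + (up c).*2, c.2)%N.
pose t x := f (s x) `[< B x >].
have mt : forall c, measurable [set x | t x = c].
  exact: measurable_update (st_measurable st_s) mB.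
have t_in1 x : in1 (t x) = `[< B x >] || kept (s x).
  by rewrite /in1 /= oddD odd_double addbF oddb.
have t_lvl1 x : lvl1 (t x) = up (s x) by rewrite /lvl1 /= half_bit_double.
have t_in2 x : in2 (t x) = in2 (s x) by [].
have t_lvl2 x : lvl2 (t x) = lvl2 (s x) by [].
have tB : region t in1 = B `|` P.
  apply/seteqP; split=> x; rewrite /region /= t_in1.
    by case/orP => [/asboolP|]; [left|right].
  by case=> [Bx|->]; rewrite ?orbT //; apply/orP; left; apply/asboolP.
have mBP : measurable (B `|` P) by meas.
have BP_null X : measurable X -> mass ((B `|` P) `&` X) = mass (B `&` X).
  move=> mX; apply/eqP; rewrite eq_le; apply/andP; split.
    apply: mass_le_null; [by meas|by meas|].
    apply: null_subset PB0; [by meas|by meas|settauto].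
  by apply: mass_le; [by meas|by meas|settauto].
exists t; split.
- split.
  + exact: mt.
  + move=> x; have := st_valid st_s x; rewrite /valid_code t_in1 t_lvl1 t_in2 t_lvl2.
    rewrite /up /kept /a.
    by case: `[< _ >] (in1 _) (in2 _) => [] [] [] //=; lia.
  + rewrite tB; symmetry; apply/(indepP _ mBP).
    apply: indep_subset (iB) => //; apply/ae_subsetP => //.
    by apply: null_subset PB0; [by meas|by meas|settauto].
  + exact: st_indep2 st_s.
  + move=> i ni.
    have tL : region t [pred c | (lvl1 c < i)%N] = L i.*2.
      by rewrite Leven; apply/seteqP; split=> x; rewrite /region /= t_lvl1.
    rewrite tL -rB ?leq_double // -BP_null; last exact: ms.
    rewrite -tL -tB; congr mass.
    by apply/seteqP; split=> x; rewrite /region /=; [move=> /andP[]|case=> -> ->].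
  + exact: st_greedy2 st_s.
- move=> x; rewrite /code_le /= leqnn andbT.
  have := odd_double_half (s x).1; rewrite -/(lvl1 _) /up /kept /a /in1.
  by case: `[< _ >] (odd _) (in2 _) => [] [] [] //=; lia.
- move=> x ax; have {}ax : a (s x) by [].
  rewrite /total /= ltn_add2r /kept /up ax andbF orbF.
  have := odd_double_half (s x).1; rewrite -/(lvl1 _).
  by case: (odd _) (`[< _ >]) => [] [] /=; lia.
Qed.

(** In a state that is maximal up to null sets, neither of the two raises applies to
    a set of positive measure. The potential is the integral of [total], written as a
    sum of measures of superlevel sets. *)
Lemma saturated_state : exists2 s, auction_state s &
  mass (region s [pred c | [&& in1 c, ~~ in2 c & (lvl1 c < n)%N]]) = 0.
Proof.
have [s0 as0] := initial_state M1 M2 n.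
pose N := (4 * n).+3.
pose T i (s : J -> code) := region s [pred c | (i < total c)%N].
pose phi s := \sum_(i < N) mass (T i s).
have mT i s : auction_state s -> measurable (T i s).
  by move=> /st_measurable; exact: measurable_region.
have T_mono i s t : state_le s t -> T i s `<=` T i t.
  move=> st x; rewrite /T /region /= => /leq_trans; apply.
  by have /andP[? ?] := st x; apply: leq_add.
have [||s st_s|s t st_s st_t st||s [st_s _ smax]] := @brezis_browder R (J -> code)
  [set s | auction_state s] (@state_le _ J) phi (\sum_(i < N) mass setT) _ _ _ _ _
  s0 as0.
- by move=> s x; rewrite /code_le !leqnn.
- move=> s t u st tu x; have /andP[? ?] := st x; have /andP[? ?] := tu x.
  by rewrite /code_le; apply/andP; split; [apply: leq_trans|apply: leq_trans]; eauto.
- by apply: ler_sum => i _; apply: mass_le => //; exact: mT.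
- by apply: ler_sum => i _; apply: mass_le; [exact: mT|exact: mT|exact: T_mono].
- move=> s st_s s_incr; exact: state_limit st_s s_incr.
have gain0 p : (exists t, [/\ auction_state t, state_le s t &
    forall x, region s p x -> (total (s x) < total (t x))%N]) ->
    mass (region s p) = 0.
  move=> [t [st_t st gain]]; have phi_eq := smax t st_t st.
  apply/eqP; rewrite eq_le mass_ge0 andbT.
  apply: (@le_trans _ _ (\sum_(i < N) mass (T i t `\` T i s))).
    apply: (@mass_le_cover _ _ _ _ _ (fun i => T i t `\` T i s)).
    - by move=> i; apply: measurableD; exact: mT.
    - exact: measurable_region (st_measurable st_s).
    - move=> x /gain sx_tx; exists (total (s x)); first exact: total_le st_s.
      by split => //; rewrite /T /region /= ltnn.
  suff -> : \sum_(i < N) mass (T i t `\` T i s) = phi t - phi s by rewrite phi_eq subrr.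
  rewrite /phi -sumrB; apply: eq_bigr => i _.
  rewrite (massDI mu (mT i t st_t) (mT i s st_s)).
  by rewrite (_ : T i t `&` T i s = T i s) ?addrK //; apply/setIidPr; exact: T_mono.
exists s => //.
have ms p := measurable_region p (st_measurable st_s).
have z1 := gain0 _ (raise1 st_s); have z2 := gain0 _ (raise2 st_s).
apply/eqP; rewrite eq_le mass_ge0 andbT -[leRHS]addr0 -{1}z1 -z2.
apply: le_trans (mass_leU mu (ms _) (ms _)).
apply: mass_le; [exact: ms|by apply: measurableU; exact: ms|].
move=> x; rewrite /region /= => /and3P[-> -> vn] /=; rewrite vn /=.
have /and3P[uv _ _] := st_valid st_s x.
have [->|uN] := eqVneq (lvl2 (s x)) (lvl1 (s x)); first by right.
by left; apply/eqP; lia.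
Qed.

End bidding.

(** * Duality *)

Section duality.
Context (R : realType) (d : measure_display) (J : measurableType d).
Context (mu : {finite_measure set J -> \bar R}) (M1 M2 : measurable_matroid mu).
Local Notation mass := (mass mu).

Lemma weak_duality F X : indep M1 F -> indep M2 F -> measurable X ->
  mass F <= rk M1 X + rk M2 (~` X).
Proof.
move=> iF1 iF2 mX; have mF := indep_measurable iF1.
rewrite (massDI mu mF mX) addrC lerD // indep_le_rk //; try by [move=> x []|meas].
- by apply: indep_subset (iF1); [by meas|apply: subset_ae => x []].
- by apply: indep_subset (iF2); [by meas|apply: subset_ae => x []].
Qed.

(** Take a saturated state with top level [n.+1], and let [F] be the intersection of
    [B1] and [B2]. Below the top level [B1] is contained in [F] up to a null set, and
    at positive second level [B2] is contained in [F]. So for [V] the set of points of first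
    level at most [i], where [i <= n], the two ranks are at most the measures of
    [F `&` V] and of the part of [F] of second level above [i]. As the second level
    exceeds the first by at most one, these two parts of [F] overlap only in first
    level exactly [i], and some [i] among [n.+1] has an overlap of measure at most
    [mass setT / n.+1%:R]. *)
Lemma approximate_duality n : exists F X, [/\ indep M1 F, indep M2 F,
  measurable X & rk M1 X + rk M2 (~` X) <= mass F + mass setT / n.+1%:R].
Proof.
have [s st_s sat] := saturated_state M1 M2 n.+1.
have ms p := measurable_region p (st_measurable st_s).
pose F := region s [pred c | in1 c && in2 c].
have mF : measurable F by exact: ms.
pose V i := region s [pred c | (lvl1 c < i)%N].
have [i ni small] : exists2 i, (i < n.+1)%N &
    mass (region s [pred c | lvl1 c == i]) <= mass setT / n.+1%:R.
  apply: contrapT => large.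
  have : \sum_(i < n.+1) mass setT / n.+1%:R <
      \sum_(i < n.+1) mass [set x | lvl1 (s x) = i].
    apply: ltr_sum; first by apply/hasP; exists ord0; rewrite ?mem_index_enum.
    move=> i _; rewrite ltNge; apply/negP => small; apply: large; exists i => //.
    by congr (_ <= _) : small; congr mass; apply/seteqP; split=> x /eqP.
  rewrite sumr_const card_ord -[ltLHS]mulr_natr divfK ?pnatr_eq0 // ltNge.
  rewrite sum_mass_le // => i; rewrite (_ : mkset _ = region s [pred c | lvl1 c == i]) //.
  by apply/seteqP; split=> x /eqP.
exists F, (V i.+1); split.
- apply: (indep_subset (B := region s in1)) => //; first by apply: subset_ae => x /andP[].
  by apply/indepP; [exact: ms|rewrite (st_indep1 st_s)].
- apply: (indep_subset (B := region s in2)) => //; first by apply: subset_ae => x /andP[].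
  by apply/indepP; [exact: ms|rewrite (st_indep2 st_s)].
- exact: ms.
pose U := region s [pred c | (i < lvl2 c)%N].
have r1 : rk M1 (V i.+1) <= mass (F `&` V i.+1).
  rewrite -(st_greedy1 st_s (leqW ni)).
  apply: mass_le_null; [exact: ms|by apply: measurableI; exact: ms|].
  apply: null_subset sat; [by apply: measurableD; [|apply: measurableI]; exact: ms|exact: ms|].
  move=> x; rewrite /F /V /region /= => -[/andP[-> vi]].
  by rewrite vi /= => /not_andP [/negP -> /=|//]; lia.
have r2 : rk M2 (~` V i.+1) <= mass (F `&` U).
  apply: (@le_trans _ _ (rk M2 U)).
    apply: rk_mono; [by apply: measurableC; exact: ms|exact: ms|].
    move=> x; rewrite /V /U /region /= => /negP; have /and3P[] := st_valid st_s x.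
    by lia.
  rewrite -(st_greedy2 st_s ni); apply: mass_le; [exact: ms|by apply: measurableI; exact: ms|].
  move=> x; rewrite /F /U /region /= => /andP[x2 iu]; split => //.
  have /and3P[_ _] := st_valid st_s x; rewrite x2 /= andbT.
  by move=> /orP[//|/eqP u0]; rewrite u0 in iu.
have mV : measurable (V i.+1) by exact: ms.
have mU : measurable U by exact: ms.
have FU : mass (F `&` U) <= mass (F `\` V i.+1) +
    mass (region s [pred c | lvl1 c == i]).
  apply: le_trans (mass_leU mu _ (ms _)); last by meas.
  apply: mass_le; [by meas|by apply: measurableU; [meas|exact: ms]|].
  move=> x; rewrite /U /V /region /= => -[Fx iu].
  have /and3P[uv _ _] := st_valid st_s x.
  have [vi|/eqP vi] := eqVneq (lvl1 (s x)) i; [by right|left; split => //].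
  by apply/negP; lia.
apply: le_trans (lerD r1 (le_trans r2 FU)) _.
by rewrite (massDI mu mF mV) addrCA addrA lerD2l.
Qed.
End duality.

Section attained.
Context (R : realType) (d : measure_display) (J : measurableType d).
Context (mu : {finite_measure set J -> \bar R}) (M1 M2 : measurable_matroid mu).
Local Notation mass := (mass mu).

Lemma rankEFin (M : measurable_matroid mu) X : rank M X = (rk M X)%:E.
Proof.
rewrite /rk /rank -massE //; case: xgetP => [A _ [[iA _] _]|_].
  exact: indep_measurable iA.
exact: measurable0.
Qed.

Definition dual_value X : R := rk M1 X + rk M2 (~` X).

Lemma dual_value_submod X Y : measurable X -> measurable Y ->
  dual_value (X `|` Y) + dual_value (X `&` Y) <= dual_value X + dual_value Y.
Proof.
move=> mX mY; rewrite /dual_value setCU setCI.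
have := rk_submod M1 mX mY.
by have := rk_submod M2 (measurableC mX) (measurableC mY); lra.
Qed.

Lemma dual_value_lim (A : nat -> set J) B (c : R) :
  (forall k, measurable (A k)) -> measurable B ->
  (forall x, exists K, forall k, (K <= k)%N -> A k x <-> B x) ->
  (forall k, dual_value (A k) <= c) -> dual_value B <= c.
Proof.
move=> mA mB AB Ac; apply/ler_addgt0Pr => e e_gt0.
have e2 : 0 < e / 2 by lra.
have [K /(_ K (leqnn K)) [AKB BAK]] := mass_ptwise_cvg mu mA mB AB e2.
have := rk_leD M1 mB (mA K).
have := rk_leD M2 (measurableC mB) (measurableC (mA K)).
have -> : ~` B `\` ~` A K = A K `\` B.
  by apply/seteqP; split=> x /=; have := pselect (A K x); tauto.
by have := Ac K; rewrite /dual_value; lra.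
Qed.

(** Submodularity makes the excess [dual_value X - c] subadditive under unions,
    because the intersection has a nonnegative excess. Hence a sequence whose
    excesses have a finite sum has tail unions of small excess, and their
    intersection has excess zero. *)
Lemma dual_value_attains (c : R) :
  (forall X, measurable X -> c <= dual_value X) ->
  (forall e, 0 < e -> exists2 X, measurable X & dual_value X <= c + e) ->
  exists2 X, measurable X & dual_value X = c.
Proof.
move=> c_le c_approx.
have half_gt0 k : 0 < 2^-1 ^+ k :> R by rewrite exprn_gt0 // invr_gt0.
have /choice [X HX] : forall k, exists X,
    measurable X /\ dual_value X <= c + 2^-1 ^+ k.
  by move=> k; have [X mX] := c_approx _ (half_gt0 k); exists X.
have mX k := (HX k).1.
pose U m N := \bigcup_(i in [set i | (m <= i <= m + N)%N]) X i.
have mU m N : measurable (U m N) by apply: bigcup_measurable.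
have U_le m N : dual_value (U m N) <= c + 2^-1 ^+ m *+ 2.
  (* the excesses of the sets in the union add up to this geometric sum *)
  suff : dual_value (U m N) <= c + 2^-1 ^+ m *+ 2 - 2^-1 ^+ (m + N)%N.
    by have := half_gt0 (m + N)%N; lra.
  elim: N => [|N IHN].
    have -> : U m 0%N = X m.
      apply/seteqP; split=> x; last by exists m => //=; rewrite addn0 leqnn.
      by move=> [i /=]; rewrite addn0 -eqn_leq => /eqP <-.
    by rewrite addn0; have := (HX m).2; lra.
  have -> : U m N.+1 = U m N `|` X (m + N.+1)%N.
    apply/seteqP; split=> x.
      move=> [i /= /andP[mi iN] Xi]; have [iE|iE] := eqVneq i (m + N.+1)%N.
        by right; rewrite -iE.
      by left; exists i => //=; lia.
    case=> [[i /= iN Xi]|Xx]; first by exists i => //=; lia.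
    by exists (m + N.+1)%N => //=; lia.
  have := dual_value_submod (mU m N) (mX (m + N.+1)%N).
  have := c_le _ (measurableI _ _ (mU m N) (mX (m + N.+1)%N)).
  have := (HX (m + N.+1)%N).2; rewrite addnS exprS.
  by have := half_gt0 (m + N)%N; lra.
pose W m := \bigcup_(i in [set i | (m <= i)%N]) X i.
have mW m : measurable (W m) by apply: bigcup_measurable.
have W_le m : dual_value (W m) <= c + 2^-1 ^+ m *+ 2.
  apply: dual_value_lim (mU m) (mW m) _ (U_le m) => x.
  have [[i /= mi Xi]|nW] := pselect (W m x).
    exists i => k ik; split=> _; first by exists i.
    by exists i => //=; lia.
  by exists 0%N => k _; split=> // -[i /= /andP[mi _] Xi]; exists i.
have mL : measurable (\bigcap_m W m) by apply: bigcapT_measurable.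
exists (\bigcap_m W m) => //; apply/eqP; rewrite eq_le c_le // andbT.
apply/ler_addgt0Pr => e e_gt0.
have [K HK] : exists K, 2^-1 ^+ K *+ 2 <= e.
  have : \forall k \near \oo, `|2^-1 ^+ k : R| < e / 2.
    apply: cvgr0_norm_lt; last lra.
    by apply: cvg_expr; rewrite ger0_norm ?invr_ge0 // invf_lt1 ?ltr1n.
  move=> [K _ /(_ K (leqnn K)) /= HK]; exists K.
  by have := ler_norm (2^-1 ^+ K : R); lra.
apply: dual_value_lim (fun k => mW (K + k)%N) mL _ _ => [x|k].
  have [Lx|nL] := pselect ((\bigcap_m W m) x).
    by exists 0%N => k _; split=> // _; exact: Lx.
  have [m nW] : exists m, ~ W m x by apply: contrapT => /forallNP nW; apply: nL => m _; apply: contrapT.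
  exists m => k mk; split=> // -[i /= Ki Xi]; exfalso; apply: nW; exists i => //=; lia.
apply: le_trans (W_le _) _; rewrite lerD2l; apply: le_trans HK.
by rewrite lerMn2r /= ler_wiXn2l // ?invr_ge0 // ?invf_le1 ?ler1n // leq_addr.
Qed.

(** For each [e], [approximate_duality] with a large number of levels gives a set
    whose dual value exceeds the measure of some common independent set by at
    most [e]; together with weak duality these are the hypotheses of
    [dual_value_attains]. *)
Lemma matroid_intersection : exists2 X, measurable X &
  dual_value X = sup [set mass F | F in indep M1 `&` indep M2].
Proof.
set S := [set mass F | F in _].
have S_ub X : measurable X -> ubound S (dual_value X).
  by move=> mX y [F [iF1 iF2] <-]; exact: weak_duality.
have S0 : S !=set0 by exists (mass set0), set0 => //; split; exact: indep0.
have supS : has_sup S by split => //; exists (dual_value set0); exact: S_ub.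
apply: dual_value_attains => [X mX|e e_gt0].
  by apply: ge_sup => //; exact: S_ub.
pose n := Num.bound (mass setT / e).
have [F [X [iF1 iF2 mX XF]]] := approximate_duality M1 M2 n.
exists X => //; apply: le_trans XF _; apply: lerD.
  by apply: sup_upper_bound => //; exists F.
rewrite ler_pdivrMr ?ltr0n // mulrC -ler_pdivrMr //.
have /archi_boundP/ltW/le_trans : 0 <= mass setT / e.
  by rewrite divr_ge0 ?mass_ge0 // ltW.
by apply; rewrite ler_nat.
Qed.
End attained.

Local Open Scope ereal_scope.

Theorem theorem6p13 (R : realType) (d : measure_display) (J : measurableType d)
    (mu : {finite_measure set J -> \bar R}) (Hmu : standard_measure_space mu)
    (M1 M2 : measurable_matroid mu) :
  exists X : set J,
    [/\ measurable X,
        forall Y : set J, measurable Y ->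
          rank M1 X + rank M2 (~` X) <= rank M1 Y + rank M2 (~` Y) &
        ereal_sup [set mu F | F in indep M1 `&` indep M2]
          = rank M1 X + rank M2 (~` X)].
Proof.
have [X mX XE] := matroid_intersection M1 M2.
set S := [set mass mu F | F in _] in XE.
have S_ub Y : measurable Y -> ubound S (dual_value M1 M2 Y).
  by move=> mY y [F [iF1 iF2] <-]; exact: weak_duality.
have S0 : S !=set0 by exists (mass mu set0), set0 => //; split; exact: indep0.
exists X; split => // [Y mY|].
  rewrite !rankEFin -!EFinD lee_fin -/(dual_value M1 M2 X) XE.
  by apply: ge_sup => //; exact: S_ub.
rewrite !rankEFin -EFinD -/(dual_value M1 M2 X) XE -ereal_sup_EFin //; last first.
  by exists (dual_value M1 M2 X); exact: S_ub.
congr ereal_sup; apply/seteqP; split=> y [].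
  move=> F [iF1 iF2] <-; exists (mass mu F); first by exists F.
  by rewrite -massE //; exact: indep_measurable iF1.
move=> z [F [iF1 iF2] <-] <-; exists F => //.
by rewrite -massE //; exact: indep_measurable iF1.
Qed.
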